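(* Let $z,q$ be complex numbers with $|q|<1$ and $z\ne 0$, such that $1+zq^{2j}\neq 0$ for all integers $j\ge 1$. Then $$\sum_{m=0}^{\infty}\frac{z^mq^{m^2}}{(q)_m}=(-zq^2;q^2)_\infty\sum_{m=0}^{\infty}\frac{z^mq^{m^2}}{(q^2;q^2)_m\,(-zq^2;q^2)_m}$$ and $$\sum_{m=0}^{\infty}\frac{z^mq^{m^2+m}}{(q)_m}=(-zq^2;q^2)_\infty\sum_{m=0}^{\infty}\frac{z^mq^{m^2+2m}}{(q^2;q^2)_m\,(-zq^2;q^2)_m}.$$
   Context: $(a;q)_n:=\prod_{j=0}^{n-1}(1-aq^j)$, $(a;q)_\infty:=\lim_{n\to\infty}(a;q)_n$, and $(q)_n:=(q;q)_n=\prod_{j=1}^{n}(1-q^j)$; empty products equal $1$. Thus $(-zq^2;q^2)_m=\prod_{j=1}^{m}(1+zq^{2j})$ and $(q^2;q^2)_m=\prod_{j=1}^{m}(1-q^{2j})$. Convention $0^0=1$. *)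

(* Defs.v *)
From Stdlib Require Import Reals.
From Coquelicot Require Export Coquelicot.

Open Scope C_scope.

(* (a;q)_n = (1 - a) (1 - a q) ... (1 - a q^(n-1)) *)
Fixpoint qpoch (a q : C) (n : nat) : C :=
  match n with
  | O => 1
  | S k => qpoch a q k * (1 - a * q ^ k)
  end.

(* P is the value of (a;q)_oo; limits in C are unique, so P is determined by
   a and q. *)
Definition is_qpoch_inf (a q P : C) : Prop :=
  filterlim (qpoch a q) eventually (locally P).

(* Main.v *)
Require Import Defs.
From Stdlib Require Import Reals Lia Lra.
From Coquelicot Require Import Coquelicot.
Open Scope C_scope.

(** Write [p = q^2].  Both identities are limits of polynomial identities in
    [z].  With the weights [w N n = (1 - p^N) (1 - p^(N-1)) ... (1 - p^(N-n+1))],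
    which vanish for [n > N], they read

      [(-zp;p)_N sum_m w N m z^m q^(m^2) / ((p)_m (-zp;p)_m)
         = sum_n w N n z^n q^(n^2) / (q)_n]

    and the same with [z^m] replaced by [(z p)^m] on the left and [z^n] by
    [(z q)^n] on the right.  After cancelling [(-zp;p)_m] the left-hand sides
    are polynomials.  Call them [B_N(z)] and [C_N(z)], and let [A_N(z)] be the
    first right-hand side, so that the claim is [B_N(z) = A_N(z)] and
    [C_N(z) = A_N(zq)].  Since [w N n / (p)_n] is a [p]-binomial coefficient,
    the two [q]-Pascal rules give

      [B_(N+1)(z) = (1 + zq) B_N(zp) + zp C_N(zp)],
      [C_(N+1)(z) = (1 + z p^(N+1)) C_N(z) + zq p^(N+1) B_N(zp)].

    The pair [(A_N(z), A_N(zq))] satisfies the same system, because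
    [1 - p^n = (1 - q^n) (1 + q^n)] turns the Pascal factor [1 - p^n] into a
    cancellation against [(q)_n] which leaves two terms.  Induction on [N]
    proves both polynomial identities together ([finite_identities]); neither
    recursion closes without the other.

    As [N] grows each weight [w N n] tends to [1], and all of them are bounded
    by [exp (1 / (1 - |p|))], so Tannery's theorem ([tannery_weights]) replaces
    the weighted sums by the infinite series, while [(-zp;p)_N] tends to
    [(-zp;p)_oo] ([series_identity_of_finite]).  All the series converge
    absolutely by a ratio test ([ex_series_eventual_ratio]) phrased without
    quotients of terms, since these vanish when [q = 0]. *)

(** * Weights and their Pascal rules *)

(** The [q]-falling factorial [(p)_N / (p)_(N-n)].  For [n > N] the truncated
    subtraction supplies the factor [1 - p^0], so that it is [0] as required,
    and sums over [n <= N] may be extended without changing them. *)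
Fixpoint qfall (p : C) (N n : nat) : C :=
  match n with
  | O => 1
  | S k => qfall p N k * (1 - p ^ (N - k))
  end.

Lemma qfall_gt (p : C) (N n : nat) : (N < n)%nat -> qfall p N n = 0.
Proof.
  induction n as [|n IH]; intros H; [lia|]. simpl.
  destruct (Nat.eq_dec n N) as [->|Hn].
  - rewrite Nat.sub_diag. simpl. ring.
  - rewrite IH by lia. ring.
Qed.

Lemma qfall_SS (p : C) (N n : nat) :
  qfall p (S N) (S n) = (1 - p ^ S N) * qfall p N n.
Proof.
  induction n as [|n IH].
  - simpl. ring.
  - change (qfall p (S N) (S (S n))) with (qfall p (S N) (S n) * (1 - p ^ (N - n))).
    rewrite IH. simpl qfall. ring.
Qed.

(** Truncation makes [p^(N-n) p^n = p^N] false for [n > N], where the weight is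
    zero; hence the weight on both sides. *)
Lemma qfall_pow (p : C) (N n : nat) :
  qfall p N n * (p ^ (N - n) * p ^ n) = qfall p N n * p ^ N.
Proof.
  destruct (Nat.le_gt_cases n N) as [H|H].
  - rewrite <- Cpow_add_r. do 2 f_equal. lia.
  - rewrite qfall_gt by exact H. ring.
Qed.

(** The two [q]-Pascal rules for the [p]-binomial coefficient
    [qfall p N n / (p)_n], with the denominators cleared. *)
Lemma qfall_pascal_l (p : C) (N n : nat) :
  qfall p (S N) (S n) = p ^ S n * qfall p N (S n) + (1 - p ^ S n) * qfall p N n.
Proof.
  rewrite qfall_SS. simpl qfall. rewrite !Cpow_S.
  transitivity (qfall p N n - p * (qfall p N n * p ^ N)); [ring|].
  rewrite <- qfall_pow. ring.
Qed.

Lemma qfall_pascal_r (p : C) (N n : nat) :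
  qfall p (S N) (S n) = qfall p N (S n) + p ^ (N - n) * (1 - p ^ S n) * qfall p N n.
Proof.
  rewrite qfall_SS. simpl qfall. rewrite !Cpow_S.
  transitivity (qfall p N n - p * (qfall p N n * p ^ N)); [ring|].
  rewrite <- qfall_pow. ring.
Qed.

(** * Shifted factorials and finite sums *)

Lemma qpoch_head (a p : C) (n : nat) :
  qpoch a p (S n) = (1 - a) * qpoch (a * p) p n.
Proof.
  induction n as [|n IH].
  - simpl. ring.
  - change (qpoch a p (S (S n))) with (qpoch a p (S n) * (1 - a * p ^ S n)).
    rewrite IH. simpl. ring.
Qed.

Lemma qpoch_add (a p : C) (m k : nat) :
  qpoch a p (m + k) = qpoch a p m * qpoch (a * p ^ m) p k.
Proof.
  induction k as [|k IH].
  - rewrite Nat.add_0_r. simpl. ring.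
  - rewrite Nat.add_succ_r. simpl. rewrite IH, Cpow_add_r. ring.
Qed.

Lemma one_minus_neq_0 (w : C) : (Cmod w < 1)%R -> 1 - w <> 0.
Proof.
  intros H E. assert (w = 1) as ->.
  { replace w with (1 - (1 - w)) by ring. rewrite E. ring. }
  rewrite Cmod_1 in H. lra.
Qed.

Lemma Cmod_pow_S_lt_1 (q : C) (n : nat) : (Cmod q < 1)%R -> (Cmod (q ^ S n) < 1)%R.
Proof.
  intros H. rewrite Cmod_pow. rewrite <- (pow1 (S n)).
  assert (H0 := Cmod_ge_0 q).
  simpl. rewrite pow1.
  assert (Cmod q ^ n <= 1)%R by (rewrite <- (pow1 n); apply pow_incr; lra).
  assert (0 <= Cmod q ^ n)%R by (apply pow_le; lra). nra.
Qed.

Lemma qpoch_self_neq_0 (q : C) (n : nat) : (Cmod q < 1)%R -> qpoch q q n <> 0.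
Proof.
  intros H. induction n as [|n IH]; simpl.
  - apply C1_nz.
  - apply Cmult_neq_0; [exact IH|].
    rewrite <- Cpow_S. apply one_minus_neq_0, Cmod_pow_S_lt_1, H.
Qed.

Lemma Cpow_square_S (q : C) (m : nat) :
  q ^ (S m ^ 2) = q ^ (m ^ 2) * (q ^ 2) ^ m * q.
Proof.
  rewrite <- Cpow_mult_r, <- Cpow_add_r, Cmult_comm, <- Cpow_S.
  f_equal. simpl. lia.
Qed.

Lemma Cpow_sqr_base (q : C) (m : nat) : (q ^ 2) ^ m = q ^ m * q ^ m.
Proof. rewrite <- Cpow_mult_l. f_equal. simpl. ring. Qed.

(** Equations between [sum_n] values are typed in a carrier that only reduces
    to [C], which [ring] does not see through. *)
Ltac in_C := match goal with |- @eq _ ?a ?b => change (@eq C a b) end.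

(** How a termwise Pascal rule becomes a recursion for sums: one summand keeps
    its index, the other drops it by one. *)
Lemma sum_n_shift (u f g : nat -> C) (c d : C) (M : nat) :
  u O = c * f O ->
  (forall m, u (S m) = c * f (S m) + d * g m) ->
  sum_n u (S M) = c * sum_n f (S M) + d * sum_n g M.
Proof.
  intros H0 HS. induction M as [|M IH].
  - rewrite !sum_Sn, !sum_O. change plus with Cplus. rewrite H0, HS. in_C. ring.
  - rewrite sum_Sn, IH, HS. rewrite (sum_Sn f (S M)), (sum_Sn g).
    change plus with Cplus. in_C. ring.
Qed.

Lemma sum_n_lin (f g : nat -> C) (c d : C) (M : nat) :
  sum_n (fun m => c * f m + d * g m) M = c * sum_n f M + d * sum_n g M.
Proof.
  induction M as [|M IH].
  - rewrite !sum_O. reflexivity.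
  - rewrite !sum_Sn, IH. change plus with Cplus. in_C. ring.
Qed.

Lemma sum_n_last_0 (f : nat -> C) (M : nat) :
  f (S M) = 0 -> sum_n f (S M) = sum_n f M.
Proof. intros H. rewrite sum_Sn, H. apply Cplus_0_r. Qed.

(** * The polynomial identities *)

Definition single_term (q : C) (N : nat) (y : C) (n : nat) : C :=
  qfall (q ^ 2) N n * (y ^ n * q ^ (n ^ 2) / qpoch q q n).

(** The summand of [B_N] for [y = z] and of [C_N] for [y = z q^2].  The last
    factor is the quotient [(-zp;p)_N / (-zp;p)_m], written as a product so that
    the recursions hold for every [z], including those at which [(-zp;p)_m]
    vanishes. *)
Definition mixed_term (q : C) (N : nat) (y z : C) (m : nat) : C :=
  qfall (q ^ 2) N m * (y ^ m * q ^ (m ^ 2) / qpoch (q ^ 2) (q ^ 2) m)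
  * qpoch (- (z * q ^ 2 * (q ^ 2) ^ m)) (q ^ 2) (N - m).

Lemma single_term_gt q N y : single_term q N y (S N) = 0.
Proof. unfold single_term. rewrite qfall_gt by lia. ring. Qed.

Lemma mixed_term_gt q N y z : mixed_term q N y z (S N) = 0.
Proof. unfold mixed_term. rewrite qfall_gt by lia. ring. Qed.

Lemma Cmod_sqr_lt_1 (q : C) : (Cmod q < 1)%R -> (Cmod (q ^ 2) < 1)%R.
Proof. apply Cmod_pow_S_lt_1. Qed.

(** The factor [1 - p^(m+1)] of the first Pascal rule is
    [(1 - q^(m+1)) (1 + q^(m+1))]: the first part cancels in [(q)_(m+1)], the
    second produces the two sums at [z p] and [z p q]. *)
Lemma single_rec (q : C) (N : nat) (z : C) :
  (Cmod q < 1)%R ->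
  sum_n (single_term q (S N) z) (S N) =
  (1 + z * q) * sum_n (single_term q N (z * q ^ 2)) N
  + z * q ^ 2 * sum_n (single_term q N (z * q ^ 2 * q)) N.
Proof.
  intros Hq.
  rewrite (sum_n_shift _ (single_term q N (z * q ^ 2))
    (fun m => z * q * single_term q N (z * q ^ 2) m
              + z * q ^ 2 * single_term q N (z * q ^ 2 * q) m) 1 1).
  - rewrite sum_n_last_0 by apply single_term_gt. rewrite sum_n_lin. in_C. ring.
  - unfold single_term. simpl. field.
  - intros m. unfold single_term. rewrite qfall_pascal_l, Cpow_square_S.
    change (qpoch q q (S m)) with (qpoch q q m * (1 - q ^ S m)).
    rewrite !Cpow_mult_l, !Cpow_sqr_base.
    assert (H1 := qpoch_self_neq_0 q m Hq).
    assert (H2 := one_minus_neq_0 _ (Cmod_pow_S_lt_1 q m Hq)).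
    rewrite Cpow_S in H2. rewrite !Cpow_S.
    field. split; assumption.
Qed.

(** The second Pascal rule is used here because it leaves the base point [z q]
    of the main sum unchanged. *)
Lemma single_rec_shifted (q : C) (N : nat) (z : C) :
  (Cmod q < 1)%R ->
  sum_n (single_term q (S N) (z * q)) (S N) =
  (1 + z * (q ^ 2) ^ S N) * sum_n (single_term q N (z * q)) N
  + z * q * (q ^ 2) ^ S N * sum_n (single_term q N (z * q ^ 2)) N.
Proof.
  intros Hq.
  rewrite (sum_n_shift _ (single_term q N (z * q))
    (fun m => z * single_term q N (z * q) m
              + z * q * single_term q N (z * q ^ 2) m) 1 ((q ^ 2) ^ S N)).
  - rewrite sum_n_last_0 by apply single_term_gt. rewrite sum_n_lin. in_C. ring.
  - unfold single_term. simpl. field.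
  - intros m. unfold single_term. rewrite qfall_pascal_r, Cpow_square_S.
    change (qpoch q q (S m)) with (qpoch q q m * (1 - q ^ S m)).
    assert (H1 := qpoch_self_neq_0 q m Hq).
    assert (H2 := one_minus_neq_0 _ (Cmod_pow_S_lt_1 q m Hq)).
    rewrite Cpow_S in H2.
    assert (HF := qfall_pow (q ^ 2) N m).
    rewrite !Cpow_mult_l, !(Cpow_S (q ^ 2)), !Cpow_sqr_base in *.
    rewrite !(Cpow_S q m), !(Cpow_S z).
    set (F := qfall _ N m) in *.
    (* Isolate [p^(N-m) p^m], the part that [qfall_pow] turns into [p^N]. *)
    transitivity (qfall (q ^ 2) N (S m) *
     (z * z ^ m * (q * q ^ m) * (q ^ (m ^ 2) * (q ^ m * q ^ m) * q) /
      (qpoch q q m * (1 - q * q ^ m))) +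
     (F * (q ^ (N - m) * q ^ (N - m) * (q ^ m * q ^ m))) *
      (z * z ^ m * q ^ 2 * (1 + q * q ^ m) * (q ^ (m ^ 2) * q ^ m) /
      (qpoch q q m))).
    + field. split; assumption.
    + rewrite HF. field. split; assumption.
Qed.

(** Peeling off the first or the last factor of a product of [N - m] factors
    needs [m < N]; for [m >= N] the weight vanishes. *)
Lemma qfall_qpoch_head (p a : C) (N m : nat) :
  qfall p N (S m) * qpoch a p (N - m)
  = qfall p N (S m) * ((1 - a) * qpoch (a * p) p (N - S m)).
Proof.
  destruct (Nat.le_gt_cases (S m) N) as [H|H].
  - rewrite <- qpoch_head. do 2 f_equal. lia.
  - rewrite qfall_gt by exact H. ring.
Qed.

Lemma qfall_qpoch_last (p z : C) (N m : nat) :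
  qfall p N (S m) * qpoch (- (z * p * p ^ S m)) p (N - m)
  = qfall p N (S m) * ((1 + z * p ^ S N) * qpoch (- (z * p * p ^ S m)) p (N - S m)).
Proof.
  destruct (Nat.le_gt_cases (S m) N) as [H|H].
  - replace (N - m)%nat with (S (N - S m)) by lia.
    cbn [qpoch]. replace (p ^ S N) with (p * p ^ S m * p ^ (N - S m)); [ring|].
    rewrite <- Cpow_S, <- Cpow_add_r. f_equal. lia.
  - rewrite qfall_gt by exact H. ring.
Qed.

(** In the first Pascal rule [p^m] moves the sum from [z] to [z p], which leaves
    one factor [1 + z p^(m+1)] too many in the tail product; expanding it gives
    a [B]-sum and, from the extra [p^m], a [C]-sum. *)
Lemma mixed_rec (q : C) (N : nat) (z : C) :
  let p := q ^ 2 in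
  (Cmod q < 1)%R ->
  sum_n (mixed_term q (S N) z z) (S N) =
  (1 + z * q) * sum_n (mixed_term q N (z * p) (z * p)) N
  + z * p * sum_n (mixed_term q N (z * p * p) (z * p)) N.
Proof.
  intros p Hq.
  rewrite (sum_n_shift _
    (fun m => 1 * mixed_term q N (z * p) (z * p) m
              + z * p * mixed_term q N (z * p * p) (z * p) m)
    (mixed_term q N (z * p) (z * p)) 1 (z * q)).
  - rewrite sum_n_lin, !sum_n_last_0 by apply mixed_term_gt. in_C. ring.
  - unfold mixed_term. fold p.
    change (S N - 0)%nat with (S N). rewrite qpoch_head, Nat.sub_0_r.
    simpl Nat.pow. simpl qfall. simpl Cpow. simpl (qpoch _ _ 0).
    replace (- (z * p * 1) * p) with (- (z * p * p * 1)) by ring.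
    field.
  - intros m. unfold mixed_term. fold p.
    rewrite qfall_pascal_l, Cpow_square_S. fold p.
    change (S N - S m)%nat with (N - m)%nat.
    change (qpoch p p (S m)) with (qpoch p p m * (1 - p * p ^ m)).
    assert (H1 := qpoch_self_neq_0 p m (Cmod_sqr_lt_1 q Hq)).
    assert (H2 := one_minus_neq_0 _ (Cmod_pow_S_lt_1 p m (Cmod_sqr_lt_1 q Hq))).
    rewrite Cpow_S in H2.
    assert (HX := qfall_qpoch_head p (- (z * p * p ^ S m)) N m).
    replace (- (z * p * p ^ S m) * p) with (- (z * p * p * p ^ S m)) in HX by ring.
    replace (- (z * p * p * p ^ m)) with (- (z * p * p ^ S m)) by (simpl; ring).
    rewrite !Cpow_mult_l.
    set (X := qpoch (- (z * p * p ^ S m)) p (N - m)) in *.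
    set (Y := qpoch _ p (N - S m)) in *.
    set (G := qfall p N (S m)) in *. set (F := qfall p N m).
    rewrite !Cpow_S in *.
    (* Isolate [G * X], the part that [qfall_qpoch_head] rewrites. *)
    transitivity ((G * X) * (p * p ^ m) *
      (z * z ^ m * (q ^ (m ^ 2) * p ^ m * q))
        / (qpoch p p m * (1 - p * p ^ m))
      + F * X * (z * z ^ m * (q ^ (m ^ 2) * p ^ m * q)) / qpoch p p m).
    + field. split; assumption.
    + rewrite HX. field. split; assumption.
Qed.

(** In the second Pascal rule the new factor of the tail product is its last
    one, [1 + z p^(N+1)], which does not depend on [m]. *)
Lemma mixed_rec_shifted (q : C) (N : nat) (z : C) :
  let p := q ^ 2 in
  (Cmod q < 1)%R ->
  sum_n (mixed_term q (S N) (z * p) z) (S N) =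
  (1 + z * p ^ S N) * sum_n (mixed_term q N (z * p) z) N
  + z * q * p ^ S N * sum_n (mixed_term q N (z * p) (z * p)) N.
Proof.
  intros p Hq.
  rewrite (sum_n_shift _ (mixed_term q N (z * p) z)
    (mixed_term q N (z * p) (z * p)) (1 + z * p ^ S N) (z * q * p ^ S N)).
  - rewrite sum_n_last_0 by apply mixed_term_gt. in_C. ring.
  - unfold mixed_term. fold p. rewrite !Nat.sub_0_r.
    simpl. field.
  - intros m. unfold mixed_term. fold p.
    rewrite qfall_pascal_r, Cpow_square_S. fold p.
    change (S N - S m)%nat with (N - m)%nat.
    change (qpoch p p (S m)) with (qpoch p p m * (1 - p * p ^ m)).
    assert (H1 := qpoch_self_neq_0 p m (Cmod_sqr_lt_1 q Hq)).
    assert (H2 := one_minus_neq_0 _ (Cmod_pow_S_lt_1 p m (Cmod_sqr_lt_1 q Hq))).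
    rewrite Cpow_S in H2.
    assert (HX := qfall_qpoch_last p z N m).
    assert (HF := qfall_pow p N m).
    replace (- (z * p * p * p ^ m)) with (- (z * p * p ^ S m)) by (simpl; ring).
    rewrite !Cpow_mult_l.
    set (X := qpoch (- (z * p * p ^ S m)) p (N - m)) in *.
    set (Y := qpoch _ p (N - S m)) in *.
    set (G := qfall p N (S m)) in *. set (F := qfall p N m) in *.
    rewrite !Cpow_S in *.
    (* Isolate the parts that [qfall_qpoch_last] and [qfall_pow] rewrite. *)
    transitivity ((G * X) *
      (z * z ^ m * (p * p ^ m) * (q ^ (m ^ 2) * p ^ m * q))
        / (qpoch p p m * (1 - p * p ^ m))
      + (F * (p ^ (N - m) * p ^ m)) * X
        * (z * z ^ m * p * (q ^ (m ^ 2) * p ^ m * q)) / qpoch p p m).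
    + field. split; assumption.
    + rewrite HX, HF. field. split; assumption.
Qed.

(** Both sides solve the same pair of recursions.  Quantifying over [z] inside
    the induction is essential, as the recursions evaluate at [z p]. *)
Lemma finite_identities (q : C) (N : nat) (z : C) :
  (Cmod q < 1)%R ->
  sum_n (mixed_term q N z z) N = sum_n (single_term q N z) N /\
  sum_n (mixed_term q N (z * q ^ 2) z) N = sum_n (single_term q N (z * q)) N.
Proof.
  intros Hq. revert z. induction N as [|N IH]; intros z.
  - rewrite !sum_O. unfold mixed_term, single_term. simpl. split; field.
  - rewrite mixed_rec, mixed_rec_shifted, single_rec, single_rec_shifted by exact Hq.
    destruct (IH z) as [_ E2]. destruct (IH (z * q ^ 2)) as [E3 E4].
    rewrite E2, E3, E4. split; reflexivity.
Qed.

(** * Limits in C and absolutely convergent series *)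

(** Reduces limits in [C] to real ones.  The topology of the complex plane is
    that of a product of two lines, hence the detour through [ball_norm]. *)
Lemma C_lim_iff (u : nat -> C) (l : C) :
  filterlim u eventually (locally l) <->
  is_lim_seq (fun n => Cmod (u n - l)) 0%R.
Proof.
  split; intros H.
  - apply is_lim_seq_spec. intros eps.
    generalize (proj1
      (@filterlim_locally_ball_norm C_AbsRing _ C_NormedModule _ _ u l) H eps).
    apply filter_imp. intros n Hn.
    rewrite Rminus_0_r, Rabs_pos_eq by apply Cmod_ge_0. exact Hn.
  - apply (proj2 (@filterlim_locally_ball_norm C_AbsRing _ C_NormedModule _ _ u l)).
    intros eps. apply is_lim_seq_spec in H. generalize (H eps).
    apply filter_imp. intros n Hn.
    rewrite Rminus_0_r, Rabs_pos_eq in Hn by apply Cmod_ge_0. exact Hn.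
Qed.

Lemma is_lim_seq_squeeze_0 (u v : nat -> R) :
  (forall n, 0 <= u n <= v n)%R -> is_lim_seq v 0%R -> is_lim_seq u 0%R.
Proof.
  intros H Hv. apply (is_lim_seq_le_le (fun _ => 0%R) u v); auto.
  apply is_lim_seq_const.
Qed.

Lemma C_lim_mult (u v : nat -> C) (l m : C) :
  filterlim u eventually (locally l) ->
  filterlim v eventually (locally m) ->
  filterlim (fun n => u n * v n) eventually (locally (l * m)).
Proof.
  rewrite !C_lim_iff. intros Hu Hv.
  apply is_lim_seq_squeeze_0 with (v := fun n =>
    (Cmod (u n - l) * (Cmod (v n - m) + Cmod m) + Cmod l * Cmod (v n - m))%R).
  - intros n. split; [apply Cmod_ge_0|].
    replace (u n * v n - l * m)
      with ((u n - l) * ((v n - m) + m) + l * (v n - m)) by ring.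
    eapply Rle_trans; [apply Cmod_triangle|]. rewrite !Cmod_mult.
    apply Rplus_le_compat_r, Rmult_le_compat_l; [apply Cmod_ge_0|].
    apply Cmod_triangle.
  - replace 0%R with (0 * (0 + Cmod m) + Cmod l * 0)%R by ring.
    apply is_lim_seq_plus'; apply is_lim_seq_mult'; try assumption.
    + apply is_lim_seq_plus'; [assumption|apply is_lim_seq_const].
    + apply is_lim_seq_const.
Qed.

Lemma Cmod_sum_n_le (a : nat -> C) (N : nat) :
  (Cmod (sum_n a N) <= sum_n (fun n => Cmod (a n)) N)%R.
Proof. apply (@norm_sum_n_m C_AbsRing C_NormedModule a 0 N). Qed.

Lemma ex_series_Cmod (a : nat -> C) :
  ex_series (fun n => Cmod (a n)) -> ex_series a.
Proof.
  apply (@ex_series_le C_AbsRing C_CompleteNormedModule). intros n. apply Rle_refl.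
Qed.

(** A ratio test that tolerates vanishing terms: only the multiplier [rho]
    has to have a limit. *)
Lemma ex_series_eventual_ratio (a rho : nat -> C) (l : R) :
  (forall n, a (S n) = rho n * a n) ->
  is_lim_seq (fun n => Cmod (rho n)) l ->
  (l < 1)%R ->
  ex_series (fun n => Cmod (a n)).
Proof.
  intros Ha Hl Hl1.
  assert (Hl0 : (0 <= l)%R).
  { apply (is_lim_seq_le (fun _ => 0%R) (fun n => Cmod (rho n)) 0%R l);
      [intros; apply Cmod_ge_0|apply is_lim_seq_const|exact Hl]. }
  set (r := ((l + 1) / 2)%R).
  assert (He : (0 < (1 - l) / 2)%R) by lra.
  apply is_lim_seq_spec in Hl. destruct (Hl (mkposreal _ He)) as [M HM].
  simpl in HM. apply (ex_series_incr_n _ M).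
  apply (@ex_series_le R_AbsRing R_CompleteNormedModule) with
    (b := fun k => (Cmod (a M) * r ^ k)%R).
  - intros k. change norm with Rabs. rewrite Rabs_pos_eq by apply Cmod_ge_0.
    induction k as [|k IH].
    + rewrite Nat.add_0_r. simpl. lra.
    + rewrite Nat.add_succ_r, Ha, Cmod_mult.
      assert (H := HM (M + k)%nat ltac:(lia)). apply Rabs_lt_between in H.
      simpl. replace (Cmod (a M) * (r * r ^ k))%R
        with (r * (Cmod (a M) * r ^ k))%R by ring.
      apply Rmult_le_compat; try apply Cmod_ge_0; [unfold r; lra|exact IH].
  - apply (ex_series_scal_l (Cmod (a M)) (fun k => (r ^ k)%R)), ex_series_geom.
    unfold r. rewrite Rabs_pos_eq; lra.
Qed.

(** Dominated convergence for series with null limit: the head of the sum tends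
    to [0] termwise, the tail is at most a tail of the dominating series. *)
Lemma tannery_null (b : nat -> nat -> R) (M : nat -> R) :
  (forall N n, 0 <= b N n <= M n)%R ->
  ex_series M ->
  (forall n, is_lim_seq (fun N => b N n) 0%R) ->
  is_lim_seq (fun N => sum_n (b N) N) 0%R.
Proof.
  intros Hb [s Hs] Hlim.
  assert (HM0 : forall n, (0 <= M n)%R).
  { intros n. destruct (Hb O n). lra. }
  assert (Hhead : forall K, is_lim_seq (fun N => sum_n (b N) K) 0%R).
  { induction K as [|K IH].
    - apply is_lim_seq_ext with (2 := Hlim O). intros n. now rewrite sum_O.
    - apply is_lim_seq_ext with (u := fun N => (sum_n (b N) K + b N (S K))%R).
      + intros n. now rewrite sum_Sn.
      + replace 0%R with (0 + 0)%R by ring. now apply is_lim_seq_plus'. }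
  assert (Htail : forall N K k,
    (sum_n (b N) (K + k) - sum_n (b N) K <= sum_n M (K + k) - sum_n M K)%R).
  { intros N K k. induction k as [|k IH].
    - rewrite Nat.add_0_r. lra.
    - rewrite Nat.add_succ_r, !sum_Sn. change plus with Rplus.
      destruct (Hb N (S (K + k))). lra. }
  assert (Hpos : forall N K, (0 <= sum_n (b N) K)%R).
  { intros N K. induction K as [|K IH].
    - rewrite sum_O. apply Hb.
    - rewrite sum_Sn. change plus with Rplus. destruct (Hb N (S K)). lra. }
  assert (Hle : forall K, (sum_n M K <= s)%R).
  { intros K. apply (is_lim_seq_incr_compare (sum_n M) s); [exact Hs|].
    intros n. rewrite sum_Sn. change plus with Rplus. specialize (HM0 (S n)). lra. }
  apply is_lim_seq_spec. intros eps.
  assert (He : (0 < eps / 2)%R) by (destruct eps; simpl; lra).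
  destruct (proj2 (is_lim_seq_spec (sum_n M) s) Hs (mkposreal _ He)) as [K HK].
  specialize (HK K (Nat.le_refl K)).
  destruct (proj2 (is_lim_seq_spec _ _) (Hhead K) (mkposreal _ He)) as [N0 HN0].
  exists (N0 + K)%nat. intros N HN. simpl in *.
  specialize (HN0 N ltac:(lia)).
  rewrite Rminus_0_r, Rabs_pos_eq in * by apply Hpos.
  apply Rabs_lt_between in HK.
  specialize (Htail N K (N - K)%nat).
  replace (K + (N - K))%nat with N in Htail by lia.
  specialize (Hle N). lra.
Qed.

(** Tannery's theorem, applied to [(c N n - 1) a n], which is dominated by
    [(K + 1) |a n|]. *)
Lemma tannery_weights (c : nat -> nat -> C) (K : R) (a : nat -> C) (l : C) :
  (forall N n, Cmod (c N n) <= K)%R ->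
  (forall n, filterlim (fun N => c N n) eventually (locally (1 : C))) ->
  ex_series (fun n => Cmod (a n)) ->
  is_series a l ->
  filterlim (fun N => sum_n (fun n => c N n * a n) N) eventually (locally l).
Proof.
  intros HK Hc Ha Hl. apply C_lim_iff.
  assert (Hl' : is_lim_seq (fun N => Cmod (sum_n a N - l)) 0%R)
    by (apply C_lim_iff; exact Hl).
  assert (Hd : is_lim_seq
    (fun N => sum_n (fun n => Cmod ((c N n - 1) * a n)) N) 0%R).
  { apply tannery_null with (M := fun n => ((K + 1) * Cmod (a n))%R).
    - intros N n. split; [apply Cmod_ge_0|]. rewrite Cmod_mult.
      apply Rmult_le_compat_r; [apply Cmod_ge_0|].
      eapply Rle_trans; [apply Cmod_triangle|].
      rewrite Cmod_opp, Cmod_1. specialize (HK N n). lra.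
    - apply (ex_series_scal_l (K + 1)%R (fun n => Cmod (a n))), Ha.
    - intros n. specialize (Hc n). apply C_lim_iff in Hc.
      apply is_lim_seq_ext with (u := fun N => (Cmod (c N n - 1) * Cmod (a n))%R).
      + intros N. now rewrite Cmod_mult.
      + replace 0%R with (0 * Cmod (a n))%R by ring.
        apply is_lim_seq_mult'; [exact Hc|apply is_lim_seq_const]. }
  apply is_lim_seq_squeeze_0 with (v := fun N =>
    (sum_n (fun n => Cmod ((c N n - 1) * a n)) N + Cmod (sum_n a N - l))%R).
  - intros N. split; [apply Cmod_ge_0|].
    assert (E : sum_n (fun n => c N n * a n) N
      = sum_n (fun n => (c N n - 1) * a n) N + sum_n a N).
    { generalize (c N). intros w. clear. induction N as [|N IH].
      - rewrite !sum_O. in_C. ring.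
      - rewrite !sum_Sn, IH. change plus with Cplus. in_C. ring. }
    rewrite E.
    match goal with |- context [Cmod (?x + ?y - l)] =>
      replace (x + y - l) with (x + (y - l)) by ring end.
    eapply Rle_trans; [apply Cmod_triangle|].
    apply Rplus_le_compat_r, Cmod_sum_n_le.
  - replace 0%R with (0 + 0)%R by ring. now apply is_lim_seq_plus'.
Qed.

(** * Convergence of the product, the weights and the series *)

Lemma is_lim_seq_Cmod_geom (a q : C) :
  (Cmod q < 1)%R -> is_lim_seq (fun n => Cmod (a * q ^ n)) 0%R.
Proof.
  intros Hq. apply is_lim_seq_ext with (u := fun n => (Cmod a * Cmod q ^ n)%R).
  - intros n. now rewrite Cmod_mult, Cmod_pow.
  - replace 0%R with (Cmod a * 0)%R by ring.
    apply is_lim_seq_mult'; [apply is_lim_seq_const|].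
    apply is_lim_seq_geom. rewrite Rabs_pos_eq; [exact Hq|apply Cmod_ge_0].
Qed.

Lemma C_lim_one_minus_geom (a q : C) :
  (Cmod q < 1)%R ->
  filterlim (fun n => 1 - a * q ^ n) eventually (locally (1 : C)).
Proof.
  intros Hq. apply C_lim_iff.
  apply is_lim_seq_ext with (2 := is_lim_seq_Cmod_geom a q Hq).
  intros n. rewrite <- Cmod_opp. f_equal. ring.
Qed.

Lemma C_lim_Cmod (u : nat -> C) (l : C) :
  filterlim u eventually (locally l) ->
  is_lim_seq (fun n => Cmod (u n)) (Cmod l).
Proof.
  intros H. apply C_lim_iff in H.
  apply is_lim_seq_ext with (u := fun n => (Cmod l + (Cmod (u n) - Cmod l))%R);
    [intros; ring|].
  replace (Finite (Cmod l)) with (Finite (Cmod l + 0)) by (f_equal; ring).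
  apply is_lim_seq_plus'; [apply is_lim_seq_const|].
  apply is_lim_seq_abs_0. apply is_lim_seq_squeeze_0 with (2 := H).
  intros n. split; [apply Rabs_pos|]. apply Rabs_le.
  assert (H1 := Cmod_triangle (u n - l) l).
  assert (H2 := Cmod_triangle (l - u n) (u n)).
  replace (u n - l + l) with (u n) in H1 by ring.
  replace (l - u n + u n) with l in H2 by ring.
  replace (Cmod (l - u n)) with (Cmod (u n - l)) in H2
    by (rewrite <- Cmod_opp; f_equal; ring). lra.
Qed.

Lemma C_lim_Cmod_1 (u : nat -> C) :
  filterlim u eventually (locally (1 : C)) ->
  is_lim_seq (fun n => Cmod (u n)) 1%R.
Proof. intros H. rewrite <- Cmod_1. now apply C_lim_Cmod. Qed.

(** The increments [- a q^n (a;q)_n] of the partial products have multiplier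
    [q (1 - a q^n)], of modulus tending to [|q| < 1], so they are summable by
    the ratio test; this also shows that the product stays bounded. *)
Lemma qpoch_converges (a q : C) :
  (Cmod q < 1)%R -> exists P, is_qpoch_inf a q P.
Proof.
  intros Hq.
  assert (Hs : ex_series (fun n => Cmod (- a * q ^ n * qpoch a q n))).
  { apply ex_series_eventual_ratio with (rho := fun n => q * (1 - a * q ^ n))
      (l := (Cmod q * 1)%R).
    - intros n. simpl. ring.
    - apply is_lim_seq_ext with (u := fun n => (Cmod q * Cmod (1 - a * q ^ n))%R).
      + intros n. now rewrite Cmod_mult.
      + apply is_lim_seq_mult'; [apply is_lim_seq_const|].
        apply C_lim_Cmod_1, C_lim_one_minus_geom, Hq.
    - lra. }
  destruct (ex_series_Cmod _ Hs) as [s Hsum]. exists (1 + s). unfold is_qpoch_inf.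
  assert (E : forall n, qpoch a q (S n)
    = 1 + sum_n (fun k => - a * q ^ k * qpoch a q k) n).
  { induction n as [|n IH].
    - rewrite sum_O. simpl. ring.
    - rewrite sum_Sn. change plus with Cplus.
      rewrite Cplus_assoc, <- IH. simpl. ring. }
  apply C_lim_iff. apply is_lim_seq_incr_1.
  assert (Hlim : is_lim_seq
    (fun n => Cmod (sum_n (fun k => - a * q ^ k * qpoch a q k) n - s)) 0%R)
    by (apply C_lim_iff; exact Hsum).
  apply is_lim_seq_ext with (2 := Hlim).
  intros n. rewrite E. f_equal. ring.
Qed.

Lemma qfall_lim (p : C) (n : nat) :
  (Cmod p < 1)%R ->
  filterlim (fun N => qfall p N n) eventually (locally (1 : C)).
Proof.
  intros Hp. induction n as [|n IH].
  - exact (filterlim_const (1 : C)).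
  - replace (1 : C) with (1 * 1) by ring. apply C_lim_mult; [exact IH|].
    apply C_lim_iff. apply (is_lim_seq_incr_n _ n).
    assert (H := C_lim_one_minus_geom 1 p Hp). apply C_lim_iff in H.
    apply is_lim_seq_ext with (2 := H). intros N.
    rewrite Nat.add_sub. f_equal. ring.
Qed.

Lemma exp_le_compat (x y : R) : (x <= y -> exp x <= exp y)%R.
Proof.
  intros [H| ->]; [apply Rlt_le, exp_increasing, H|apply Rle_refl].
Qed.

(** Each factor is at most [1 + |p|^j <= exp (|p|^j)], and the exponents [j] in
    one product are distinct, so they add up to less than a geometric series. *)
Lemma qfall_bounded (p : C) :
  (Cmod p < 1)%R ->
  forall N n, (Cmod (qfall p N n) <= exp (/ (1 - Cmod p)))%R.
Proof.
  intros Hp. set (r := Cmod p).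
  assert (Hr : (0 <= r)%R) by apply Cmod_ge_0. fold r in Hp.
  assert (Hge1 : forall x, (0 <= x -> 1 <= exp x)%R).
  { intros x Hx. assert (H := exp_ineq1_le x). lra. }
  (* The exponent is [1 + r + ... + r^N]. *)
  assert (Hstep : forall N n,
    (Cmod (qfall p N n) <= exp ((1 - r ^ S N) / (1 - r)))%R).
  { induction N as [|N IH]; intros n.
    - destruct n as [|n].
      + simpl. rewrite Cmod_1. apply Hge1. apply Rdiv_le_0_compat; lra.
      + rewrite qfall_gt by lia. rewrite Cmod_0. apply Rlt_le, exp_pos.
    - destruct n as [|n].
      + simpl qfall. rewrite Cmod_1. apply Hge1. apply Rdiv_le_0_compat; [|lra].
        assert (r ^ S (S N) <= 1 ^ S (S N))%R by (apply pow_incr; lra).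
        rewrite pow1 in *. lra.
      + rewrite qfall_SS, Cmod_mult.
        replace ((1 - r ^ S (S N)) / (1 - r))%R
          with (r ^ S N + (1 - r ^ S N) / (1 - r))%R by (simpl; field; lra).
        rewrite exp_plus.
        apply Rmult_le_compat; try apply Cmod_ge_0; [|apply IH].
        eapply Rle_trans; [apply Cmod_triangle|].
        rewrite Cmod_opp, Cmod_1, Cmod_pow. apply exp_ineq1_le. }
  intros N n. eapply Rle_trans; [apply Hstep|].
  assert (0 <= r ^ S N)%R by (apply pow_le; exact Hr).
  apply exp_le_compat. unfold Rdiv. rewrite <- (Rmult_1_l (/ (1 - r))) at 2.
  apply Rmult_le_compat_r; [|lra].
  apply Rlt_le, Rinv_0_lt_compat. lra.
Qed.

(** The multiplier of [y^m q^(m^2) / D m] is [y q p^m / e m], which tends to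
    [0].  Every series in the theorem has this form, with the linear exponent of
    [q] absorbed into [y]. *)
Lemma theta_quotient_summable (q y : C) (D e : nat -> C) :
  (Cmod q < 1)%R ->
  (forall m, D (S m) = D m * e m) ->
  (forall m, D m <> 0) ->
  filterlim e eventually (locally (1 : C)) ->
  ex_series (fun m => Cmod (y ^ m * q ^ (m ^ 2) / D m)).
Proof.
  intros Hq HD HD0 He.
  assert (He0 : forall m, e m <> 0).
  { intros m E. apply (HD0 (S m)). rewrite HD, E. ring. }
  apply ex_series_eventual_ratio with
    (rho := fun m => y * q * (q ^ 2) ^ m / e m) (l := (0 / 1)%R).
  - intros m. rewrite HD, Cpow_square_S, Cpow_S. field. split; auto.
  - apply is_lim_seq_ext with
      (u := fun m => (Cmod (y * q * (q ^ 2) ^ m) / Cmod (e m))%R).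
    + intros m. now rewrite Cmod_div.
    + apply is_lim_seq_div'; [| |lra].
      * apply is_lim_seq_Cmod_geom, Cmod_pow_S_lt_1, Hq.
      * apply C_lim_Cmod_1, He.
  - lra.
Qed.

Lemma single_summable (q y : C) :
  (Cmod q < 1)%R -> ex_series (fun m => Cmod (y ^ m * q ^ (m ^ 2) / qpoch q q m)).
Proof.
  intros Hq.
  apply theta_quotient_summable with (e := fun m => 1 - q * q ^ m); auto.
  - intros m. now apply qpoch_self_neq_0.
  - now apply C_lim_one_minus_geom.
Qed.

Lemma qpoch_neq_0 (a p : C) (n : nat) :
  (forall j, 1 - a * p ^ j <> 0) -> qpoch a p n <> 0.
Proof.
  intros H. induction n as [|n IH]; simpl; [apply C1_nz|].
  now apply Cmult_neq_0.
Qed.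

Lemma mixed_summable (q y a : C) :
  (Cmod q < 1)%R ->
  (forall j, 1 - a * (q ^ 2) ^ j <> 0) ->
  ex_series (fun m => Cmod (y ^ m * q ^ (m ^ 2) /
    (qpoch (q ^ 2) (q ^ 2) m * qpoch a (q ^ 2) m))).
Proof.
  intros Hq Ha. assert (Hp := Cmod_sqr_lt_1 q Hq).
  apply theta_quotient_summable with
    (e := fun m => (1 - q ^ 2 * (q ^ 2) ^ m) * (1 - a * (q ^ 2) ^ m)); auto.
  - intros m. cbn [qpoch]. ring.
  - intros m. apply Cmult_neq_0; [now apply qpoch_self_neq_0|now apply qpoch_neq_0].
  - assert (H := C_lim_mult _ _ _ _
      (C_lim_one_minus_geom (q ^ 2) (q ^ 2) Hp) (C_lim_one_minus_geom a (q ^ 2) Hp)).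
    rewrite Cmult_1_l in H. exact H.
Qed.

(** * Passage to the limit *)

(** The weighted sum over [m] times the partial product [(-zp;p)_N] is the
    polynomial sum of [mixed_term]; let [N] tend to infinity on both sides and
    compare limits. *)
Lemma series_identity_of_finite (q y y' z P L R1 : C) :
  (Cmod q < 1)%R ->
  (forall j, 1 - - (z * q ^ 2) * (q ^ 2) ^ j <> 0) ->
  (forall N, sum_n (mixed_term q N y z) N = sum_n (single_term q N y') N) ->
  is_qpoch_inf (- (z * q ^ 2)) (q ^ 2) P ->
  is_series (fun m => y' ^ m * q ^ (m ^ 2) / qpoch q q m) L ->
  is_series (fun m => y ^ m * q ^ (m ^ 2) /
    (qpoch (q ^ 2) (q ^ 2) m * qpoch (- (z * q ^ 2)) (q ^ 2) m)) R1 ->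
  L = P * R1.
Proof.
  intros Hq Hz Hfin HP HL HR.
  assert (Hp := Cmod_sqr_lt_1 q Hq).
  assert (HA : filterlim (fun N => sum_n (single_term q N y') N)
    eventually (locally L)).
  { apply (tannery_weights (qfall (q ^ 2)) _ _ L (qfall_bounded _ Hp)
      (fun n => qfall_lim _ n Hp)); [now apply single_summable|exact HL]. }
  assert (HB := tannery_weights (qfall (q ^ 2)) _ _ R1 (qfall_bounded _ Hp)
      (fun n => qfall_lim _ n Hp) (mixed_summable q y _ Hq Hz) HR).
  assert (HPB := C_lim_mult _ _ _ _ HP HB).
  apply (@filterlim_locally_unique nat C_AbsRing C_NormedModule eventually _
    (fun N => sum_n (single_term q N y') N)); [exact HA|].
  eapply filterlim_ext; [|exact HPB].
  intros N. cbv beta. rewrite <- Hfin. symmetry.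
  rewrite <- (sum_n_mult_l (K := C_Ring)).
  apply sum_n_ext_loc. intros m Hm. unfold mixed_term. change mult with Cmult.
  replace (- (z * q ^ 2 * (q ^ 2) ^ m)) with (- (z * q ^ 2) * (q ^ 2) ^ m) by ring.
  replace (qpoch (- (z * q ^ 2)) (q ^ 2) N) with
    (qpoch (- (z * q ^ 2)) (q ^ 2) (m + (N - m))) by (f_equal; lia).
  rewrite qpoch_add. in_C. field.
  split; [now apply qpoch_neq_0|now apply qpoch_self_neq_0].
Qed.

Theorem theorem5p1 :
  forall (z q : C),
    (Cmod q < 1)%R ->
    z <> 0 ->
    (forall j : nat, (1 <= j)%nat -> 1 + z * q ^ (2 * j) <> 0) ->
    exists P L1 R1 L2 R2 : C,
      is_qpoch_inf (- (z * q ^ 2)) (q ^ 2) P /\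
      is_series (fun m : nat => z ^ m * q ^ (m ^ 2) / qpoch q q m) L1 /\
      is_series (fun m : nat =>
        z ^ m * q ^ (m ^ 2) /
          (qpoch (q ^ 2) (q ^ 2) m * qpoch (- (z * q ^ 2)) (q ^ 2) m)) R1 /\
      is_series (fun m : nat => z ^ m * q ^ (m ^ 2 + m) / qpoch q q m) L2 /\
      is_series (fun m : nat =>
        z ^ m * q ^ (m ^ 2 + 2 * m) /
          (qpoch (q ^ 2) (q ^ 2) m * qpoch (- (z * q ^ 2)) (q ^ 2) m)) R2 /\
      L1 = P * R1 /\
      L2 = P * R2.
Proof.
  intros z q Hq _ Hz.
  assert (Hz' : forall j, 1 - - (z * q ^ 2) * (q ^ 2) ^ j <> 0).
  { intros j. replace (1 - - (z * q ^ 2) * (q ^ 2) ^ j) with (1 + z * q ^ (2 * S j)).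
    - apply Hz. lia.
    - rewrite Cpow_mult_r, Cpow_S. ring. }
  destruct (qpoch_converges (- (z * q ^ 2)) (q ^ 2) (Cmod_sqr_lt_1 q Hq)) as [P HP].
  destruct (ex_series_Cmod _ (single_summable q z Hq)) as [L1 HL1].
  destruct (ex_series_Cmod _ (single_summable q (z * q) Hq)) as [L2 HL2].
  destruct (ex_series_Cmod _ (mixed_summable q z _ Hq Hz')) as [R1 HR1].
  destruct (ex_series_Cmod _ (mixed_summable q (z * q ^ 2) _ Hq Hz')) as [R2 HR2].
  exists P, L1, R1, L2, R2. repeat split; try assumption.
  - apply is_series_ext with (2 := HL2). intros m.
    rewrite Cpow_mult_l, Cpow_add_r. unfold Cdiv. in_C. ring.
  - apply is_series_ext with (2 := HR2). intros m.
    rewrite Cpow_mult_l, Cpow_add_r, Cpow_mult_r. unfold Cdiv. in_C. ring.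
  - apply series_identity_of_finite with (q := q) (y := z) (y' := z) (z := z);
      try assumption.
    intros N. now apply finite_identities.
  - apply series_identity_of_finite with (q := q) (y := z * q ^ 2) (y' := z * q) (z := z);
      try assumption.
    intros N. now apply finite_identities.
Qed.
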